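(* Let $T$ be an inverse semigroup and let $\mathcal{U}$ be a right inverse $T$-set. Then the semigroup $K(\mathcal{U})$ is inverse, and the generalized inverse $k^*$ of each $k\in K(\mathcal{U})$ is its adjoint $k^{\dag}$.
   Context: A semigroup $T$ is inverse if every $t\in T$ has a unique $t^*\in T$ (its generalized inverse) with $tt^*t=t$ and $t^*tt^*=t^*$. A right $T$-set is a set $\mathcal{U}$ with a map $\mathcal{U}\times T\to\mathcal{U}$, $(u,t)\mapsto ut$, such that $(ut)t'=u(tt')$. A right regular $T$-set is a right $T$-set $\mathcal{U}$ with a map $\langle\cdot|\cdot\rangle_{\mathcal{U}}:\mathcal{U}\times\mathcal{U}\to T$ (the right pairing) such that for all $u,u'\in\mathcal{U}$, $t\in T$: (R-i) $\langle u|u't\rangle_{\mathcal{U}}=\langle u|u'\rangle_{\mathcal{U}}t$; (R-ii) $\langle u|u'\rangle_{\mathcal{U}}^*=\langle u'|u\rangle_{\mathcal{U}}$; (R-iii) $u\langle u|u\rangle_{\mathcal{U}}=u$. A right inverse $T$-set is a right regular $T$-set such that moreover (R-iv) $u\langle u'|u\rangle_{\mathcal{U}}=u$ and $u'\langle u|u'\rangle_{\mathcal{U}}=u'$ imply $u=u'$, for all $u,u'\in\mathcal{U}$. A map $\varphi:\mathcal{U}\to\mathcal{U}$ is adjointable if there is a map $\psi:\mathcal{U}\to\mathcal{U}$ (an adjoint of $\varphi$) with $\langle\psi(v)|u\rangle_{\mathcal{U}}=\langle v|\varphi(u)\rangle_{\mathcal{U}}$ for all $u,v\in\mathcal{U}$;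 on a right inverse $T$-set the adjoint is unique and is denoted $\varphi^{\dag}$. For $u,v\in\mathcal{U}$ let $\omega_{v,u}:\mathcal{U}\to\mathcal{U}$ be $\omega_{v,u}(u')=v\langle u|u'\rangle_{\mathcal{U}}$; it is adjointable with adjoint $\omega_{u,v}$. Put $K(\mathcal{U})=\{\omega_{v,u}\mid u,v\in\mathcal{U}\}$, a semigroup under composition of maps. *)

(* Defs.v *)
From HB Require Import structures.
From mathcomp Require Import all_boot.
From mathcomp Require Import boolp.

Set Implicit Arguments.
Unset Strict Implicit.
Unset Printing Implicit Defensive.

Import Algebra.

Declare Scope invsg_scope.
Delimit Scope invsg_scope with I.
Local Open Scope group_scope.
Local Open Scope invsg_scope.

(* [semigroupType] asks for a choice structure on the carrier; under the
   classical axioms of [boolp] every type, even an empty one, has one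
   ([gen_eqMixin], [gen_choiceMixin]). *)
Definition generalized_inverse (S : semigroupType) (t s : S) : Prop :=
  t * s * t = t /\ s * t * s = s.

Definition inverse_semigroup (S : semigroupType) : Prop :=
  forall t : S, exists! s : S, generalized_inverse t s.

(* The map [t |-> t^*]: it is determined by [hS]. *)
Definition ginv (S : semigroupType) (hS : inverse_semigroup S) (t : S) : S :=
  sval (cid (hS t)).

HB.mixin Record Semigroup_isInverse S of Semigroup S := {
  inverse_semigroupP : inverse_semigroup S
}.

#[short(type="inverseSemigroupType")]
HB.structure Definition InverseSemigroup :=
  {S of Semigroup_isInverse S & Semigroup S}.

Notation "t ^*" := (ginv inverse_semigroupP t) : invsg_scope.

HB.mixin Record isRightSet (T : inverseSemigroupType) (U : Type) := {
  ract : U -> T -> U;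
  ractA : forall u t t', ract (ract u t) t' = ract u (t * t')
}.

#[short(type="rightSetType")]
HB.structure Definition RightSet (T : inverseSemigroupType) :=
  {U of isRightSet T U}.

Notation "u *> t" := (ract u t) (at level 40, left associativity) : invsg_scope.

HB.mixin Record RightSet_isRegular (T : inverseSemigroupType) (U : Type)
    of RightSet T U := {
  rpair : U -> U -> T;
  rpairMr : forall (u u' : U) (t : T), rpair u (u' *> t) = rpair u u' * t;
  rpair_star : forall u u' : U, (rpair u u')^* = rpair u' u;
  ract_rpair : forall u : U, u *> rpair u u = u
}.

#[short(type="rightRegularSetType")]
HB.structure Definition RightRegularSet (T : inverseSemigroupType) :=
  {U of RightSet_isRegular T U & RightSet T U}.

Notation "<| u , v |>" := (rpair u v)
  (at level 0, u at level 99, v at level 99, format "<| u ,  v |>")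
  : invsg_scope.

HB.mixin Record RightRegularSet_isInverse (T : inverseSemigroupType) (U : Type)
    of RightRegularSet T U := {
  ract_rpair_inj : forall u u' : U,
    u *> <| u', u |> = u -> u' *> <| u, u' |> = u' -> u = u'
}.

#[short(type="rightInverseSetType")]
HB.structure Definition RightInverseSet (T : inverseSemigroupType) :=
  {U of RightRegularSet_isInverse T U & RightRegularSet T U}.

Section InverseSemigroupTheory.
Variable S : inverseSemigroupType.
Implicit Types a b e f s t : S.

Lemma starP t : generalized_inverse t t^*.
Proof. by rewrite /ginv; case: cid => s []. Qed.

Lemma star_eq t s : generalized_inverse t s -> t^* = s.
Proof. by rewrite /ginv; case: cid => s' [] /= _; apply. Qed.

Lemma starK t : t^*^* = t.
Proof. by apply: star_eq; have [? ?] := starP t. Qed.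

Lemma mul_idem e f : e * e = e -> f * f = f -> (e * f) * (e * f) = e * f.
Proof.
move=> ee ff; set x := (e * f)^*.
have [p q] : generalized_inverse (e * f) x by exact: starP.
have xE : x = f * x * e.
  apply: star_eq; split.
    transitivity (e * (f * f) * x * (e * e) * f); first by rewrite !mulgA.
    by rewrite ee ff -[RHS]p !mulgA.
  transitivity (f * x * (e * e) * (f * f) * x * e); first by rewrite !mulgA.
  rewrite ee ff; transitivity (f * (x * (e * f) * x) * e).
    by rewrite !mulgA.
  by rewrite q.
have xx : x * x = x.
  rewrite {1}xE {2}xE; transitivity (f * (x * (e * f) * x) * e).
    by rewrite !mulgA.
  by rewrite q -xE.
have xs : x^* = x by apply: star_eq; rewrite /generalized_inverse !xx.
by move: xs; rewrite /x starK -/x => ->.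
Qed.

Lemma idem_commute e f : e * e = e -> f * f = f -> e * f = f * e.
Proof.
move=> ee ff; have ef := mul_idem ee ff; have fe := mul_idem ff ee.
have h1 : (e * f)^* = e * f.
  by apply: star_eq; rewrite /generalized_inverse !ef.
rewrite -h1; apply: star_eq; split.
  transitivity (e * (f * f) * (e * e) * f); first by rewrite !mulgA.
  by rewrite ee ff -[RHS]ef !mulgA.
transitivity (f * (e * e) * (f * f) * e); first by rewrite !mulgA.
by rewrite ee ff -[RHS]fe !mulgA.
Qed.

Lemma starM a b : (a * b)^* = b^* * a^*.
Proof.
have [a1 a2] := starP a; have [b1 b2] := starP b.
have c : (b * b^*) * (a^* * a) = (a^* * a) * (b * b^*).
  by apply: idem_commute; rewrite mulgA ?b1 ?a2.
apply: star_eq; split.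
  transitivity (a * ((b * b^*) * (a^* * a)) * b); first by rewrite !mulgA.
  rewrite c; transitivity ((a * a^* * a) * (b * b^* * b)).
    by rewrite !mulgA.
  by rewrite a1 b1.
transitivity (b^* * ((a^* * a) * (b * b^*)) * a^*); first by rewrite !mulgA.
rewrite -c; transitivity ((b^* * b * b^*) * (a^* * a * a^*)).
  by rewrite !mulgA.
by rewrite a2 b2.
Qed.

End InverseSemigroupTheory.

Section Adjoints.
Variable T : inverseSemigroupType.

Definition is_adjoint (U : rightRegularSetType T) (phi psi : U -> U) : Prop :=
  forall u v : U, <| psi v, u |> = <| v, phi u |>.

Definition adjointable (U : rightRegularSetType T) (phi : U -> U) : Prop :=
  exists psi : U -> U, is_adjoint phi psi.

Definition omega (U : rightRegularSetType T) (v u : U) : U -> U :=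
  fun u' => v *> <| u, u' |>.

Definition K (U : rightRegularSetType T) : Type :=
  {phi : U -> U | exists u v : U, phi = omega v u}.

Lemma omega_adjoint (U : rightRegularSetType T) (u v : U) :
  is_adjoint (omega v u) (omega u v).
Proof.
by move=> a b; rewrite /omega -rpair_star !rpairMr starM !rpair_star.
Qed.

Lemma omega_comp (U : rightRegularSetType T) (v u v' u' : U) :
  omega v u \o omega v' u' = omega (v *> <| u, v' |>) u'.
Proof. by apply/funext => x; rewrite /omega /= rpairMr ractA. Qed.

Lemma adjoint_unique (U : rightInverseSetType T) (phi psi psi' : U -> U) :
  is_adjoint phi psi -> is_adjoint phi psi' -> psi = psi'.
Proof.
move=> h h'; apply/funext => v; have E u := etrans (h u v) (esym (h' u v)).
by apply: ract_rpair_inj; [rewrite -E|rewrite E]; rewrite ract_rpair.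
Qed.

(* The adjoint, unique by [adjoint_unique]. *)
Definition dagger (U : rightInverseSetType T) (phi : U -> U)
    (hphi : adjointable phi) : U -> U :=
  sval (cid hphi).

Lemma daggerP (U : rightInverseSetType T) (phi : U -> U)
  (hphi : adjointable phi) : is_adjoint phi (dagger hphi).
Proof. exact: svalP. Qed.

HB.instance Definition _ (U : rightRegularSetType T) := gen_eqMixin (K U).
HB.instance Definition _ (U : rightRegularSetType T) := gen_choiceMixin (K U).

Lemma K_adjointable (U : rightRegularSetType T) (k : K U) :
  adjointable (sval k).
Proof.
case: k => phi /= [u [v ->]].
by exists (omega u v); exact: omega_adjoint.
Qed.

Lemma K_comp_subproof (U : rightRegularSetType T) (k k' : K U) :
  exists u v : U, sval k \o sval k' = omega v u.
Proof.
case: k k' => phi /= [u [v ->]] [phi' /= [u' [v' ->]]].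
by exists u', (v *> <| u, v' |>); exact: omega_comp.
Qed.

Definition K_comp (U : rightRegularSetType T) (k k' : K U) : K U :=
  exist _ (sval k \o sval k') (K_comp_subproof k k').

Lemma K_compA (U : rightRegularSetType T) : associative (@K_comp U).
Proof. by move=> k1 k2 k3; apply: eq_exist. Qed.

HB.instance Definition _ (U : rightRegularSetType T) :=
  isSemigroup.Build (K U) (@K_compA U).

End Adjoints.

(* Main.v *)
Require Import Defs.
From mathcomp Require Import all_boot.
From mathcomp Require Import boolp.

(** Regularity of [K U] is a computation: the idempotents [<| u, u |>] and
    [<| v, v |>] of [T] commute, so the factors inserted by
    [omega v u \o omega u v \o omega v u] are absorbed, and [omega u v] is a
    generalized inverse of [omega v u] ([omega_adjoint_regular]).

    Uniqueness of generalized inverses rests on (R-iv), used to show that every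
    idempotent of [K U] is its own adjoint ([omega_idem_selfadjoint]).  First
    rewrite the idempotent as [omega v u] with [<| u, u |> = <| v, v |>]
    ([omega_balanced]).  Idempotency then says [v *> <| u, v |> = v], and
    idempotency of the adjoint [omega u v] says [u *> <| v, u |> = u]; hence
    [u = v], and [omega u u] is self-adjoint.

    If [s] and [s'] are generalized inverses of [k], then [k * s] and [k * s']
    are idempotents that absorb each other: multiplying either of them on the
    left by the other leaves it unchanged.  Their product is thus itself
    idempotent, hence self-adjoint, and taking adjoints shows that they commute
    ([K_idem_commute]), so they are equal.  The mirror argument gives
    [s * k = s' * k], whence [s = s * k * s = s' * k * s = s' * k * s' = s']. *)

Set Implicit Arguments.
Unset Strict Implicit.
Unset Printing Implicit Defensive.

Import Algebra.
Local Open Scope group_scope.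
Local Open Scope invsg_scope.

Section RightRegularSets.
Variables (T : inverseSemigroupType) (U : rightRegularSetType T).
Implicit Types (u v x : U) (t : T).

Lemma rpairMl u x t : <| u *> t, x |> = t^* * <| u, x |>.
Proof. by rewrite -rpair_star rpairMr starM rpair_star. Qed.

Lemma rpair_mull u x : <| u, u |> * <| u, x |> = <| u, x |>.
Proof. by rewrite -{1}rpair_star -rpairMl ract_rpair. Qed.

Lemma rpair_mulr u x : <| u, x |> * <| x, x |> = <| u, x |>.
Proof. by rewrite -rpairMr ract_rpair. Qed.

Lemma rpair_commute u v :
  <| u, u |> * <| v, v |> = <| v, v |> * <| u, u |>.
Proof. by apply: idem_commute; exact: rpair_mull. Qed.

Lemma ract_rpair_absorb u v : v *> <| u, u |> *> <| v, v |> = v *> <| u, u |>.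
Proof. by rewrite ractA rpair_commute -ractA ract_rpair. Qed.

Lemma omega_absorb u v : omega (v *> <| u, u |>) u = omega v u.
Proof. by apply/funext => x; rewrite /omega ractA rpair_mull. Qed.

Lemma omega_adjoint_regular u v :
  omega v u \o omega u v \o omega v u = omega v u.
Proof. by rewrite !omega_comp ract_rpair_absorb omega_absorb. Qed.

(** Cutting each of [u] and [v] down by the pairing of the other with itself
    leaves the operator unchanged and makes both self-pairings equal to
    [<| u, u |> * <| v, v |>]. *)
Lemma omega_balanced u v :
  exists u' v' : U, omega v u = omega v' u' /\ <| u', u' |> = <| v', v' |>.
Proof.
exists (u *> <| v, v |>), (v *> <| u, u |>); split.
  apply/funext => x.
  by rewrite /omega rpairMl rpair_star -ractA ract_rpair_absorb ractA rpair_mull.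
rewrite !rpairMl !rpairMr !rpair_star (rpair_commute u v) mulgA rpair_mull.
by rewrite -rpair_commute mulgA rpair_mull.
Qed.

Lemma omega_idem_ract u v : <| u, u |> = <| v, v |> ->
  omega v u \o omega v u = omega v u -> v *> <| u, v |> = v.
Proof.
move=> uv /(congr1 (fun f => f u)); rewrite omega_comp /omega uv.
by rewrite ract_rpair ractA rpair_mulr.
Qed.

Lemma is_adjoint_comp (phi phi' psi psi' : U -> U) :
  is_adjoint phi psi -> is_adjoint phi' psi' ->
  is_adjoint (phi \o phi') (psi' \o psi).
Proof. by move=> h h' u v; rewrite /= h' h. Qed.

End RightRegularSets.

Section RightInverseSets.
Variables (T : inverseSemigroupType) (U : rightInverseSetType T).
Implicit Types (u v : U) (e f k s : K U).

(** Once [u] and [v] are balanced, idempotency of [omega v u] and of its adjoint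
    [omega u v] gives the two hypotheses of (R-iv), so that [u = v] and the two
    operators coincide. *)
Lemma omega_idem_selfadjoint u v :
  omega v u \o omega v u = omega v u -> is_adjoint (omega v u) (omega v u).
Proof.
have [u' [v' [-> uv]]] := omega_balanced u v => idem.
have idem_adj : omega u' v' \o omega u' v' = omega u' v'.
  have h := omega_adjoint u' v'; apply: (adjoint_unique _ h).
  by rewrite -idem; exact: (is_adjoint_comp h h).
have -> : u' = v'.
  by apply: ract_rpair_inj; apply: omega_idem_ract.
exact: omega_adjoint.
Qed.

Lemma K_idem_selfadjoint e : e * e = e -> is_adjoint (sval e) (sval e).
Proof.
move=> /(congr1 sval); case: e => phi /= [u [v ->]].
exact: omega_idem_selfadjoint.
Qed.

(** [e], [f] and [e * f] are all self-adjoint, while [f * e] is the adjoint of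
    [e * f]. *)
Lemma K_idem_commute e f : e * e = e -> f * f = f ->
  (e * f) * (e * f) = e * f -> e * f = f * e.
Proof.
move=> ee ff efef; apply: eq_exist.
apply: (adjoint_unique (phi := sval (e * f))).
  exact: K_idem_selfadjoint efef.
by apply: is_adjoint_comp; exact: K_idem_selfadjoint.
Qed.

Lemma K_idem_eql e f : e * f = f -> f * e = e -> e = f.
Proof.
move=> ef fe.
have ee : e * e = e by rewrite -{2}fe mulgA ef.
have ff : f * f = f by rewrite -{2}ef mulgA fe.
by have := K_idem_commute ee ff; rewrite ef fe => ->.
Qed.

Lemma K_idem_eqr e f : e * f = e -> f * e = f -> e = f.
Proof.
move=> ef fe.
have ee : e * e = e by rewrite -{1}ef -mulgA fe.
have ff : f * f = f by rewrite -{1}fe -mulgA ef.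
by have := K_idem_commute ee ff; rewrite ef fe => ->.
Qed.

Lemma K_generalized_inverse_unique k s s' :
  generalized_inverse k s -> generalized_inverse k s' -> s = s'.
Proof.
move=> [ksk sks] [ks'k s'ks'].
have ks : k * s = k * s' by apply: K_idem_eql; rewrite mulgA ?ksk ?ks'k.
have sk : s * k = s' * k.
  by apply: K_idem_eqr; rewrite -mulgA (mulgA k) ?ksk ?ks'k.
by rewrite -sks sk -mulgA ks mulgA.
Qed.

Lemma K_adjoint_generalized_inverse k :
  exists s : K U, is_adjoint (sval k) (sval s) /\ generalized_inverse k s.
Proof.
case: k => phi /= [u [v phiE]].
exists (exist _ (omega u v) (ex_intro _ v (ex_intro _ u erefl))).
split; first by rewrite /= phiE; exact: omega_adjoint.
by split; apply: eq_exist; rewrite /= ?phiE; exact: omega_adjoint_regular.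
Qed.

Lemma K_inverse_semigroup : inverse_semigroup (K U).
Proof.
move=> k; have [s [_ ks]] := K_adjoint_generalized_inverse k.
by exists s; split=> // s'; exact: K_generalized_inverse_unique.
Qed.

End RightInverseSets.

Theorem theorem3p19 (T : inverseSemigroupType) (U : rightInverseSetType T) :
  exists hK : inverse_semigroup (K U),
    forall k : K U, sval (ginv hK k) = dagger (K_adjointable k).
Proof.
exists (@K_inverse_semigroup T U) => k.
have [s [adj ks]] := K_adjoint_generalized_inverse k.
have -> : ginv (@K_inverse_semigroup T U) k = s.
  by rewrite /ginv; case: cid => s' [] /= _; apply.
exact: adjoint_unique adj (daggerP _).
Qed.
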